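(* Let $n\ge 2$ and let $\mathcal{I}=\{I_i: i=1,\dots,d_n\}$ be a generating set of the $O(n)$-invariant polynomials on $\mathcal{T}_n$. For $\Gamma\in\mathcal{T}_n$ let $\widetilde q_1(\Gamma),\dots,\widetilde q_n(\Gamma)$ be the elementary symmetric functions of the $n$ eigenvalues of the symmetric nonnegative definite matrix $\Gamma^{*2}$ (i.e., up to sign, the coefficients of its characteristic polynomial). Then there are polynomials $F_1,\dots,F_{d_n}\in\mathbb{R}[y_1,\dots,y_n]$ such that $I_i(R)=F_i(\widetilde q_1(R),\dots,\widetilde q_n(R))$ for every diagonal tensor $R$ and every $i$, and the $d_n$ polynomial conditions $$I_i(\Gamma)=F_i\big(\widetilde q_1(\Gamma),\dots,\widetilde q_n(\Gamma)\big),\qquad i=1,\dots,d_n,$$ are necessary and sufficient for $\Gamma\in\mathcal{T}_n$ to be fully decoupleable.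
   Context: $\mathcal{T}_n$ is the set of real $n\times n\times n$ tensors $\Gamma=(\Gamma^i_{jk})$ that are trilinear (completely symmetric), i.e. $\Gamma^i_{jk}=\Gamma^i_{kj}=\Gamma^j_{ik}$. The group $O(n)$ acts on $\mathcal{T}_n$ by $(\sigma\circ\Gamma)^i_{jk}=\sum_{i',j',k'}\sigma_{ii'}\sigma_{jj'}\sigma_{kk'}\Gamma^{i'}_{j'k'}$. A tensor $R\in\mathcal{T}_n$ is diagonal (in fully decoupled reduced form) if $R^i_{jk}=0$ unless $i=j=k$; $\Gamma$ is fully decoupleable if $\sigma\circ\Gamma$ is diagonal for some $\sigma\in O(n)$. A polynomial $I$ in the entries of $\Gamma$ is $O(n)$-invariant if $I(\sigma\circ\Gamma)=I(\Gamma)$ for all $\sigma\in O(n)$, $\Gamma\in\mathcal{T}_n$. A generating set is a finite set of $O(n)$-invariant polynomials such that every $O(n)$-invariant polynomial on $\mathcal{T}_n$ is a polynomial in its members. $\Gamma^{*2}$ is the $n\times n$ matrix with entries $\Gamma^{*2}_{k\ell}=\sum_{i,j}\Gamma^i_{jk}\Gamma^i_{j\ell}$. *)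

(* Defs.v *)
From HB Require Import structures.
From mathcomp Require Import all_boot all_order all_algebra.
From mathcomp Require Import spectral complex.
From mathcomp Require Import reals.
From mathcomp Require Import mpoly.

Set Implicit Arguments.
Unset Strict Implicit.
Unset Printing Implicit Defensive.

Import Order.TTheory GRing.Theory Num.Theory.

Local Open Scope ring_scope.

(* [G i j k] is the entry with upper index [i] and lower indices [j], [k]. *)
Definition tensor (R : realType) (n : nat) := 'I_n -> 'I_n -> 'I_n -> R.

Definition trilinear (R : realType) (n : nat) (G : tensor R n) : Prop :=
  forall i j k, G i j k = G i k j /\ G i j k = G j i k.

Definition orthogonal_mx (R : realType) (n : nat) (s : 'M[R]_n) : Prop :=
  s *m s^T = 1%:M.

Definition tensor_act (R : realType) (n : nat) (s : 'M[R]_n) (G : tensor R n) :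
    tensor R n :=
  fun i j k => \sum_(i' < n) \sum_(j' < n) \sum_(k' < n)
    s i i' * s j j' * s k k' * G i' j' k'.

Definition diagonal_tensor (R : realType) (n : nat) (G : tensor R n) : Prop :=
  trilinear G /\ forall i j k, ~ (i = j /\ j = k) -> G i j k = 0.

Definition fully_decoupleable (R : realType) (n : nat) (G : tensor R n) : Prop :=
  exists s : 'M[R]_n, orthogonal_mx s /\ diagonal_tensor (tensor_act s G).

(* Polynomials in the entries have one variable per index triple; the variables
   are numbered by the enumeration of the type of triples. *)
Definition tensor_poly (R : realType) (n : nat) :=
  {mpoly R[#|{: 'I_n * 'I_n * 'I_n}|]}.

Definition tensor_eval (R : realType) (n : nat) (I : tensor_poly R n)
    (G : tensor R n) : R :=
  I.@[fun v => let: (i, j, k) := enum_val v in G i j k].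

Definition On_invariant (R : realType) (n : nat) (I : tensor_poly R n) : Prop :=
  forall (s : 'M[R]_n) (G : tensor R n), orthogonal_mx s -> trilinear G ->
    tensor_eval I (tensor_act s G) = tensor_eval I G.

(* "Is a polynomial in the members" is an equality of functions on the space of
   trilinear tensors: polynomials in all entries that agree there are not
   distinguished. *)
Definition generating_set (R : realType) (n d : nat)
    (I : 'I_d -> tensor_poly R n) : Prop :=
  (forall i, On_invariant (I i)) /\
  (forall J : tensor_poly R n, On_invariant J ->
     exists P : {mpoly R[d]}, forall G : tensor R n, trilinear G ->
       tensor_eval J G = P.@[fun i => tensor_eval (I i) G]).

Definition star2 (R : realType) (n : nat) (G : tensor R n) : 'M[R]_n :=
  \matrix_(k < n, l < n) \sum_(i < n) \sum_(j < n) G i j k * G i j l.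

(* [l] lists the eigenvalues of [A] with algebraic multiplicity. *)
Definition is_spectrum (R : realType) (n : nat) (A : 'M[R]_n)
    (l : n.-tuple R) : bool :=
  char_poly A == \prod_(a <- l) ('X - a%:P).

Lemma star2_spectrum (R : realType) (n : nat) (G : tensor R n) :
  exists l, is_spectrum (star2 G) l.
Proof.
set A := star2 G; pose Ac := map_mx (real_complex R) A.
have symA : A^T = A.
  apply/matrixP => k l; rewrite !mxE; apply: eq_bigr => i _.
  by apply: eq_bigr => j _; rewrite mulrC.
have hA : Ac \is hermsymmx.
  apply: realsym_hermsym.
    by apply/is_hermitianmxP; rewrite expr0 scale1r map_mx_id // /Ac map_trmx symA.
  apply/mxOverP => i j; rewrite mxE.
  by apply/complex_realP; exists (A i j).
have /orthomx_spectralP EA := hermitian_normalmx hA.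
have /mxOverP spR := hermitian_spectral_diag_real hA.
pose l := [tuple complex.Re (spectral_diag Ac 0 i) | i < n].
exists l; apply/eqP.
apply: (@map_poly_inj _ _ (real_complex R)).
rewrite map_char_poly -/Ac rmorph_prod /=.
have -> : char_poly Ac = char_poly (diag_mx (spectral_diag Ac)).
  rewrite /char_poly /char_poly_mx [in LHS]EA; set P := spectralmx Ac.
  have Pu : P \in unitmx by exact: spectral_unit.
  have PV : map_mx polyC (invmx P) *m map_mx polyC P = 1%:M.
    by rewrite -map_mxM mulVmx // map_mx1.
  rewrite !map_mxM /= -[X in X - _]mulmx1 -PV mulmxA -scalar_mxC -mulmxBl.
  by rewrite -mulmxBr !det_mulmx mulrAC -det_mulmx PV det1 mul1r.
rewrite char_poly_trig ?diag_mx_is_trig // big_map big_enum /=.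
apply: eq_bigr => i _; rewrite rmorphB /= map_polyX map_polyC /= mxE eqxx.
by have /complex_realP[x ->] := spR 0 i.
Qed.

Definition star2_eigenvalues (R : realType) (n : nat) (G : tensor R n) :
    n.-tuple R :=
  xchoose (star2_spectrum G).

(* Indices are shifted: [qtilde G k] is the elementary symmetric function of
   degree [k.+1]. *)
Definition qtilde (R : realType) (n : nat) (G : tensor R n) (k : 'I_n) : R :=
  (mesym n R k.+1).@[tnth (star2_eigenvalues G)].

Lemma qtilde_char_poly (R : realType) (n : nat) (G : tensor R n) (k : 'I_n) :
  qtilde G k = (-1) ^+ k.+1 * (char_poly (star2 G))`_(n - k.+1).
Proof.
have kn : (k.+1 < n.+1)%N by rewrite ltnS.
rewrite (eqP (xchooseP (star2_spectrum G))) -/(star2_eigenvalues G).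
by rewrite (mroots_coeff _ (Ordinal kn)) /= mulrA -expr2 sqrr_sign mul1r.
Qed.

(* Main.v *)
Require Import Defs.
From mathcomp Require Import all_boot all_order all_algebra.
From mathcomp Require Import reals.
From mathcomp Require Import mpoly.
From mathcomp Require Import fingroup perm spectral complex ring.

Set Implicit Arguments.
Unset Strict Implicit.
Unset Printing Implicit Defensive.

Import Order.TTheory GRing.Theory Num.Theory.

Local Open Scope ring_scope.

(** On a diagonal tensor with entries [r i], an invariant polynomial is
    unchanged by signed permutations of the [r i], hence is a polynomial in the
    elementary symmetric functions of the [r i ^+ 2], which are the eigenvalues
    of [star2]; this gives the [F i].

    For sufficiency, let [M k] be the matrix with entries [G i j k].  The sum of
    the squared Frobenius norms of the commutators of [M k] and [M l] is an
    invariant polynomial that vanishes on diagonal tensors.  The conditions say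
    that the generators take the same values at [G] as at the diagonal tensor
    whose entries are the square roots of the eigenvalues of [star2 G], so this
    polynomial vanishes at [G].  The symmetric matrices [M k] therefore commute
    and are diagonalized by one orthogonal matrix, which makes the transformed
    tensor vanish when its first two indices differ, hence, by symmetry, off the
    diagonal. *)

(** * Simultaneous orthogonal diagonalization of commuting real symmetric matrices *)

Lemma hermitian_eigenvalue_real (C : numClosedFieldType) (n : nat)
    (A : 'M[C]_n) (v : 'rV[C]_n) (a : C) :
  map_mx Num.conj A^T = A -> v != 0 -> v *m A = a *: v -> a \is Num.real.
Proof.
move=> hA v0 vA; apply/CrealP.
pose vs := map_mx Num.conj v^T.
(* The Hermitian form of [A] at [v] is computed twice, as [a] and as [a^*] times the nonzero squared
   norm of [v]. *)
have h1 : v *m A *m vs = a *: (v *m vs) by rewrite vA -scalemxAl.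
have hN : map_mx Num.conj (v *m vs)^T = v *m vs.
  rewrite trmx_mul map_mxM /=; congr (_ *m _); apply/matrixP => i j.
  by rewrite !mxE conjCK.
have h2 : v *m A *m vs = a^* *: (v *m vs).
  have -> : v *m A *m vs = map_mx Num.conj (v *m A *m vs)^T.
    rewrite !trmx_mul !map_mxM hA /= -mulmxA; congr (_ *m _).
    by apply/matrixP => i j; rewrite !mxE conjCK.
  rewrite h1 linearZ /=; apply/matrixP => i j.
  by rewrite -[in RHS]hN !mxE rmorphM.
have N0 : (v *m vs) 0 0 != 0.
  rewrite mxE; apply: contra v0 => /eqP /psumr_eq0P h; apply/eqP/rowP => j.
  have := h _ j isT; rewrite !mxE -normCK => e; apply/eqP.
  rewrite -normr_eq0 -sqrf_eq0; apply/eqP/e => k _.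
  by rewrite !mxE -normCK exprn_ge0.
apply: (mulIf N0); move: (congr1 (fun M : 'M_1 => M 0 0) h1).
by rewrite h2 !mxE.
Qed.

(** [common_eigenvector] is applied over the complex numbers, where eigenvalues exist. Since all the
    eigenvalues are real, the real and imaginary parts of the common eigenvector satisfy the same
    equations, and one of them is nonzero. *)
Lemma common_real_eigenvector (R : rcfType) (n : nat) (As : seq 'M[R]_n.+1) :
  {in As, forall A, A^T = A} -> {in As &, forall A B, comm_mx A B} ->
  exists2 v : 'rV[R]_n.+1, v != 0 &
    {in As, forall A, exists a, v *m A = a *: v}.
Proof.
move=> symA comA; pose f := real_complex R.
have [|v v0 /allP hv] := @common_eigenvector _ _ (map (map_mx f) As) isT.
  move=> _ _ /mapP[A hA ->] /mapP[B hB ->].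
  by rewrite /comm_mx -!map_mxM comA.
have eigv A : A \in As -> exists a : R, v *m map_mx f A = f a *: v.
  move=> hA; have /sub_rVP[a va] := hv _ (map_f _ hA).
  have /complex_realP[b ab] : a \is Num.real.
    apply: hermitian_eigenvalue_real v0 va.
    apply/matrixP => i j; rewrite -[in RHS](symA A hA) !mxE.
    by apply/CrealP/complex_realP; eexists.
  by exists b; rewrite va ab.
have eigRe A : A \in As -> exists a : R,
    map_mx (@complex.Re R) v *m A = a *: map_mx (@complex.Re R) v.
  move=> /eigv[a /matrixP va]; exists a; apply/matrixP => i j.
  have /(congr1 (@complex.Re R)) := va i j; rewrite !mxE raddf_sum /=.
  case: (v i j) => x y /=; rewrite mul0r subr0 => <-; apply: eq_bigr => k _.
  by rewrite !mxE; case: (v i k) => {}x {}y /=; rewrite mulr0 subr0.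
have eigIm A : A \in As -> exists a : R,
    map_mx (@complex.Im R) v *m A = a *: map_mx (@complex.Im R) v.
  move=> /eigv[a /matrixP va]; exists a; apply/matrixP => i j.
  have /(congr1 (@complex.Im R)) := va i j; rewrite !mxE raddf_sum /=.
  case: (v i j) => x y /=; rewrite mul0r addr0 => <-; apply: eq_bigr => k _.
  by rewrite !mxE; case: (v i k) => {}x {}y /=; rewrite mulr0 add0r.
have [Re0|Ren0] := eqVneq (map_mx (@complex.Re R) v) 0.
  have [Im0|Imn0] := eqVneq (map_mx (@complex.Im R) v) 0.
    case/eqP: v0; apply/matrixP => i j.
    move: (congr1 (fun M : 'rV_n.+1 => M i j) Re0).
    move: (congr1 (fun M : 'rV_n.+1 => M i j) Im0).
    by rewrite !mxE; case: (v i j) => x y /= -> ->.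
  by exists (map_mx (@complex.Im R) v).
by exists (map_mx (@complex.Re R) v).
Qed.

Lemma mulmx_tr_eq0 (R : realDomainType) (n : nat) (v : 'rV[R]_n) :
  ((v *m v^T) 0 0 == 0) = (v == 0).
Proof.
apply/eqP/eqP => [|->]; last by rewrite mul0mx mxE.
rewrite mxE => /psumr_eq0P h; apply/rowP => j.
have := h _ j isT; rewrite !mxE -expr2 => e; apply/eqP.
by rewrite -sqrf_eq0; apply/eqP/e => k _; rewrite !mxE -expr2 sqr_ge0.
Qed.

Lemma mulmx_tr_ge0 (R : realDomainType) (n : nat) (v : 'rV[R]_n) :
  0 <= (v *m v^T) 0 0.
Proof. by rewrite mxE sumr_ge0 // => k _; rewrite !mxE -expr2 sqr_ge0. Qed.

(* The Householder reflection exchanging the first basis vector and [u]. *)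
Lemma unit_row_completion (R : realFieldType) (n : nat) (u : 'rV[R]_n.+1) :
  u *m u^T = 1%:M -> exists2 s : 'M[R]_n.+1, s *m s^T = 1%:M & row 0 s = u.
Proof.
move=> uu; pose e : 'rV[R]_n.+1 := delta_mx 0 0.
have ee : e *m e^T = 1%:M.
  by rewrite trmx_delta mul_delta_mx; apply/matrixP => i j; rewrite !ord1 !mxE.
have [eqw|w0] := eqVneq (u - e) 0.
  exists 1%:M; first by rewrite trmx1 mulmx1.
  by rewrite row1 -/e; apply/esym/eqP; rewrite -subr_eq0 eqw.
set w := u - e in w0; pose N := (w *m w^T) 0 0.
have N0 : N != 0 by rewrite mulmx_tr_eq0.
have wwN : w *m w^T = N%:M by apply/matrixP => i j; rewrite !ord1 [in RHS]mxE.
have eu : u *m e^T = e *m u^T.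
  by rewrite -[LHS]trmxK trmx_mul trmxK; apply/matrixP => i j; rewrite !ord1 mxE.
(* Both [u] and [e] are unit vectors, so the squared norm of [u - e] is twice the product of [e]
   with [e - u]. *)
have ew : e *m w^T = (- (N / 2))%:M.
  have : w *m w^T = (-2) *: (e *m w^T).
    rewrite /w linearB /= !mulmxBl !mulmxBr uu ee eu.
    move: (e *m u^T) => x; apply/matrixP => i j; rewrite !mxE; ring.
  rewrite wwN => /(congr1 (fun x => (-2)^-1 *: x)).
  rewrite scalerA mulVf ?oppr_eq0 ?pnatr_eq0 //.
  by rewrite scale1r => <-; rewrite scale_scalar_mx; congr (_%:M); field.
have ewu : e + w = u by rewrite /w addrC subrK.
clearbody w.
pose H : 'M[R]_n.+1 := 1%:M - (2 / N) *: (w^T *m w).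
have HT : H^T = H by rewrite /H linearB linearZ /= trmx1 trmx_mul trmxK.
exists H.
  rewrite HT /H mulmxBl mul1mx mulmxBr mulmx1 -scalemxAl -scalemxAr.
  rewrite mulmxA -[w^T *m w *m w^T]mulmxA wwN mul_mx_scalar -scalemxAl !scalerA.
  have -> : 2 / N * (2 / N * N) = 2 / N + 2 / N by field.
  by rewrite scalerDl opprB addrK subrK.
rewrite rowE -/e /H mulmxBr mulmx1 -scalemxAr mulmxA ew mul_scalar_mx scalerA.
have -> : 2 / N * - (N / 2) = -1 by field.
by rewrite scaleN1r opprK.
Qed.

(** Induction on the size. Take an orthogonal matrix whose first row is a common unit eigenvector:
    conjugation by it clears the first row off the diagonal, and by symmetry the first column. The
    lower right blocks are again symmetric and commute. *)
Lemma codiagonalizable_symmetric (R : rcfType) (n : nat) (As : seq 'M[R]_n) :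
  {in As, forall A, A^T = A} -> {in As &, forall A B, comm_mx A B} ->
  exists2 s : 'M[R]_n, s *m s^T = 1%:M &
    {in As, forall A, is_diag_mx (s *m A *m s^T)}.
Proof.
elim: n As => [|n IHn] As symA comA.
  by exists 1%:M => [|A _]; rewrite ?trmx1 ?mulmx1 ?flatmx0 ?mx0_is_diag.
have [v v0 eigv] := @common_real_eigenvector _ _ As symA comA.
pose c := (Num.sqrt ((v *m v^T) 0 0))^-1.
have [|s ss row_s] := @unit_row_completion _ _ (c *: v).
  apply/matrixP => i j; rewrite !ord1 linearZ /= -scalemxAl -scalemxAr scalerA.
  rewrite mxE /c -invfM -expr2 sqr_sqrtr ?mulmx_tr_ge0 // mulVf ?mulmx_tr_eq0 //.
  by rewrite mxE.
have ss' : s^T *m s = 1%:M by apply: mulmx1C.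
pose B (A : 'M[R]_n.+1) : 'M[R]_(1 + n) := s *m A *m s^T.
have symB A : A \in As -> (B A)^T = B A.
  by move=> hA; rewrite /B !trmx_mul trmxK symA // mulmxA.
have mulB X Y : B X *m B Y = B (X *m Y).
  by rewrite /B !mulmxA -[s *m X *m s^T *m s]mulmxA ss' mulmx1.
have blockB A : A \in As ->
    exists a : R, B A = block_mx a%:M 0 0 (drsubmx (B A)).
  move=> hA; have [a va] := eigv A hA; exists a.
  have rowB : row 0 (B A) = a *: delta_mx 0 0.
    rewrite /B !row_mul row_s -scalemxAl va scalerA mulrC -scalerA -scalemxAl.
    by rewrite -row_s -row_mul ss row1.
  have B0 j : B A 0 j = a * (j == 0)%:R.
    by move/rowP: rowB => /(_ j); rewrite !mxE.
  have B0T j : B A j 0 = a * (j == 0)%:R by rewrite -[B A]symB // mxE B0.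
  have l0 : lshift n (0 : 'I_1) = 0 :> 'I_n.+1 by apply: val_inj.
  move: (B A) B0 B0T => X X0 X0T.
  rewrite -[LHS]submxK; congr block_mx; apply/matrixP => i j.
  - by rewrite !ord1 !mxE l0 X0 mulr1.
  - by rewrite !ord1 !mxE l0 X0 mulr0.
  - by rewrite !ord1 !mxE l0 X0T mulr0.
have [_ /mapP[A hA ->]|_ _ /mapP[X hX ->] /mapP[Y hY ->]|t tt diagt] :=
    IHn (map (fun A => drsubmx (B A)) As).
- by rewrite trmx_drsub symB.
- have [x hx] := blockB X hX; have [y hy] := blockB Y hY.
  have := mulB X Y; rewrite (comA X Y hX hY) -mulB.
  move: (drsubmx (B X)) (drsubmx (B Y)) hx hy => DX DY -> ->.
  rewrite !mulmx_block.
  by move=> /eq_block_mx[_ _ _]; rewrite !mul0mx !add0r.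
pose T : 'M[R]_(1 + n) := block_mx 1%:M 0 0 t.
have TT : T *m T^T = 1%:M.
  rewrite /T tr_block_mx !trmx0 trmx1 mulmx_block.
  by rewrite !(mul0mx, mulmx0, mulmx1, addr0) add0r tt -scalar_mx_block.
exists (T *m s).
  by rewrite trmx_mul mulmxA -[_ *m s *m s^T]mulmxA ss mulmx1.
move=> A hA; have -> : T *m s *m A *m (T *m s)^T = T *m B A *m T^T.
  by rewrite trmx_mul /B !mulmxA.
have [a ->] := blockB A hA.
rewrite /T tr_block_mx !trmx0 trmx1 !mulmx_block.
rewrite !(mul0mx, mulmx0, mulmx1, mul1mx, addr0, add0r).
rewrite [is_diag_mx _](@is_diag_block_mx _ 1 n 1 n) // !eqxx.
rewrite scalar_mx_is_diag /=.
by apply: diagt; apply: map_f.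
Qed.

(** * Slices of a tensor and the orthogonal action on them *)

Definition slice (R : realType) (n : nat) (G : tensor R n) (k : 'I_n) :
    'M[R]_n :=
  \matrix_(i, j) G i j k.

(** Splits the action into a rotation of the family of slices and a conjugation of each one, so that
    invariance can be checked for the two separately. *)
Lemma slice_tensor_act (R : realType) (n : nat) (s : 'M[R]_n) (G : tensor R n)
    (k : 'I_n) :
  slice (tensor_act s G) k = s *m (\sum_l s k l *: slice G l) *m s^T.
Proof.
apply/matrixP => i j; rewrite !mxE /tensor_act exchange_big /=.
apply: eq_bigr => j' _; rewrite !mxE mulr_suml; apply: eq_bigr => i' _.
rewrite !summxE !(mulr_suml, mulr_sumr); apply: eq_bigr => k' _.
by rewrite !mxE; ring.
Qed.

Lemma tensor_eval_ext (R : realType) (n : nat) (I : tensor_poly R n)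
    (G H : tensor R n) :
  (forall i j k, G i j k = H i j k) -> tensor_eval I G = tensor_eval I H.
Proof. by move=> GH; apply: meval_eq => v; case: enum_val => [[i j] k]. Qed.

Lemma trilinear_act (R : realType) (n : nat) (s : 'M[R]_n) (G : tensor R n) :
  trilinear G -> trilinear (tensor_act s G).
Proof.
move=> triG i j k; split; rewrite /tensor_act.
  apply: eq_bigr => i' _; rewrite exchange_big /=.
  apply: eq_bigr => k' _; apply: eq_bigr => j' _.
  by have [-> _] := triG i' j' k'; ring.
rewrite exchange_big /=; apply: eq_bigr => j' _; apply: eq_bigr => i' _.
by apply: eq_bigr => k' _; have [_ ->] := triG i' j' k'; ring.
Qed.

Lemma trilinear_slice_sym (R : realType) (n : nat) (G : tensor R n) (k : 'I_n) :
  trilinear G -> (slice G k)^T = slice G k.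
Proof. by move=> triG; apply/matrixP => i j; rewrite !mxE; case: (triG j i k). Qed.

Lemma mxtrace_mul_trE (A : comNzRingType) (m n : nat) (M N : 'M[A]_(m, n)) :
  \tr (M *m N^T) = \sum_i \sum_j M i j * N i j.
Proof.
by apply: eq_bigr => i _; rewrite mxE; apply: eq_bigr => j _; rewrite mxE.
Qed.

Lemma star2_slice (R : realType) (n : nat) (G : tensor R n) (k l : 'I_n) :
  star2 G k l = \tr (slice G k *m (slice G l)^T).
Proof.
rewrite mxtrace_mul_trE mxE.
by apply: eq_bigr => i _; apply: eq_bigr => j _; rewrite !mxE.
Qed.

Lemma mxtrace_conj_orthogonal (A : comNzRingType) (n : nat) (s M N : 'M[A]_n) :
  s^T *m s = 1%:M ->
  \tr ((s *m M *m s^T) *m (s *m N *m s^T)^T) = \tr (M *m N^T).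
Proof.
move=> ss; rewrite !trmx_mul trmxK !mulmxA -[s *m M *m s^T *m s]mulmxA ss mulmx1.
by rewrite mxtrace_mulC !mulmxA ss mul1mx.
Qed.

(** After expansion, the coefficient of the pairing of [f l] with [f l'] is the entry [l l'] of
    [s^T *m s]. *)
Lemma sum_sqr_norm_orthogonal (A : comNzRingType) (m n p : nat) (s : 'M[A]_n)
    (f : 'I_n -> 'M[A]_(m, p)) :
  s^T *m s = 1%:M ->
  \sum_k \tr ((\sum_l s k l *: f l) *m (\sum_l s k l *: f l)^T) =
  \sum_k \tr (f k *m (f k)^T).
Proof.
move=> ss.
transitivity (\sum_l \sum_l' (s^T *m s) l l' * \tr (f l *m (f l')^T)).
  under [RHS]eq_bigr => l _ do under eq_bigr => l' _ do rewrite mxE mulr_suml.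
  under [RHS]eq_bigr => l _ do rewrite exchange_big /=.
  rewrite [RHS]exchange_big /=; apply: eq_bigr => k _.
  rewrite mulmx_suml raddf_sum; apply: eq_bigr => l _.
  rewrite linear_sum mulmx_sumr raddf_sum; apply: eq_bigr => l' _ /=.
  by rewrite linearZ /= -scalemxAl -scalemxAr !mxtraceZ !mxE mulrA.
apply: eq_bigr => l _; rewrite ss (bigD1 l) //= big1 => [|l' nl].
  by rewrite mxE eqxx mul1r addr0.
by rewrite mxE eq_sym (negPf nl) mul0r.
Qed.

(** * The commutator invariant *)

Definition commutator (A : comNzRingType) (n : nat) (M N : 'M[A]_n) : 'M[A]_n :=
  M *m N - N *m M.

(** Stated over any commutative ring, so that one formula gives both the polynomial, on matrices of
    variables, and its real values. *)
Definition noncommutativity (A : comNzRingType) (m n : nat)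
    (M : 'I_m -> 'M[A]_n) : A :=
  \sum_k \sum_l \tr (commutator (M k) (M l) *m (commutator (M k) (M l))^T).

Lemma mxtrace_mul_tr_ge0 (R : realDomainType) (m n : nat) (N : 'M[R]_(m, n)) :
  0 <= \tr (N *m N^T).
Proof.
rewrite mxtrace_mul_trE sumr_ge0 // => i _; rewrite sumr_ge0 // => j _.
by rewrite -expr2 sqr_ge0.
Qed.

Lemma mxtrace_mul_tr_eq0 (R : realDomainType) (m n : nat) (N : 'M[R]_(m, n)) :
  \tr (N *m N^T) = 0 -> N = 0.
Proof.
have sq_ge0 i j : 0 <= N i j * N i j by rewrite -expr2 sqr_ge0.
rewrite mxtrace_mul_trE => /psumr_eq0P h; apply/matrixP => i j.
have /psumr_eq0P h' : \sum_j N i j * N i j = 0.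
  by apply: h => // k _; rewrite sumr_ge0.
by apply/eqP; rewrite mxE -sqrf_eq0 expr2; apply/eqP/h'.
Qed.

Lemma noncommutativity_eq0 (R : realDomainType) (m n : nat)
    (M : 'I_m -> 'M[R]_n) :
  noncommutativity M = 0 <-> forall k l, comm_mx (M k) (M l).
Proof.
split=> [/psumr_eq0P h k l|comM]; last first.
  rewrite /noncommutativity big1 // => k _; rewrite big1 // => l _.
  by rewrite /commutator comM subrr mul0mx mxtrace0.
apply/eqP; rewrite -subr_eq0; apply/eqP/mxtrace_mul_tr_eq0.
have /psumr_eq0P h' :=
  h (fun i _ => sumr_ge0 _ (fun j _ => mxtrace_mul_tr_ge0 _)) k isT.
by apply: h' => // j _; apply: mxtrace_mul_tr_ge0.
Qed.

Lemma noncommutativity_slice_act (R : realType) (n : nat) (s : 'M[R]_n)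
    (G : tensor R n) :
  orthogonal_mx s ->
  noncommutativity (slice (tensor_act s G)) = noncommutativity (slice G).
Proof.
move=> /mulmx1C ss; pose S := slice G.
have comE k l : commutator (slice (tensor_act s G) k) (slice (tensor_act s G) l)
    = s *m (\sum_l' s l l' *: \sum_k' s k k' *: commutator (S k') (S l')) *m s^T.
  rewrite /commutator !slice_tensor_act -/S.
  have mulE X Y : s *m X *m s^T *m (s *m Y *m s^T) = s *m (X *m Y) *m s^T.
    by rewrite !mulmxA -[s *m X *m s^T *m s]mulmxA ss mulmx1.
  rewrite !mulE -mulmxBl -mulmxBr; congr (_ *m _ *m _).
  rewrite mulmx_sumr mulmx_suml -sumrB; apply: eq_bigr => l' _.
  rewrite -scalemxAr -scalemxAl -scalerBr mulmx_suml mulmx_sumr -sumrB.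
  congr (_ *: _); apply: eq_bigr => k' _.
  by rewrite -scalemxAr -scalemxAl -scalerBr.
(* Conjugation preserves the Frobenius norm; the rotation of the index [l] is undone first, that of
   [k] afterwards. *)
transitivity (\sum_k \sum_l \tr (
    (\sum_k' s k k' *: commutator (S k') (S l)) *m
    (\sum_k' s k k' *: commutator (S k') (S l))^T)).
  apply: eq_bigr => k _; rewrite -[RHS](sum_sqr_norm_orthogonal _ ss).
  by apply: eq_bigr => l _; rewrite comE mxtrace_conj_orthogonal.
rewrite exchange_big [RHS]exchange_big /=; apply: eq_bigr => l _.
exact: (sum_sqr_norm_orthogonal (fun k => commutator (S k) (S l))).
Qed.

Definition noncommutativity_poly (R : realType) (n : nat) : tensor_poly R n :=
  noncommutativity (fun k => \matrix_(i, j) 'X_(enum_rank (i, j, k))).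

Lemma tensor_eval_noncommutativity (R : realType) (n : nat) (G : tensor R n) :
  tensor_eval (noncommutativity_poly R n) G = noncommutativity (slice G).
Proof.
rewrite /tensor_eval; set ev := (X in meval X).
have evS k : map_mx (meval ev) (\matrix_(i, j) 'X_(enum_rank (i, j, k)))
    = slice G k.
  by apply/matrixP => i j; rewrite !mxE mevalXU /ev enum_rankK.
rewrite /noncommutativity_poly /noncommutativity rmorph_sum /=.
apply: eq_bigr => k _; rewrite rmorph_sum /=; apply: eq_bigr => l _.
by rewrite -trace_map_mx map_mxM -map_trmx /commutator map_mxB !map_mxM /= !evS.
Qed.

Lemma noncommutativity_poly_invariant (R : realType) (n : nat) :
  On_invariant (noncommutativity_poly R n).
Proof.
move=> s G os _.
by rewrite !tensor_eval_noncommutativity noncommutativity_slice_act.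
Qed.

Lemma diagonal_slice_comm (R : realType) (n : nat) (D : tensor R n) :
  diagonal_tensor D -> forall k l, comm_mx (slice D k) (slice D l).
Proof.
move=> [_ D0] k l.
have dS a : slice D a = diag_mx (\row_i D i i a).
  apply/matrixP => i j; rewrite !mxE; have [->|nij] := eqVneq i j.
    by rewrite mulr1n.
  by rewrite mulr0n D0 // => -[ij _]; rewrite ij eqxx in nij.
by rewrite !dS; apply: diag_mx_comm.
Qed.

Lemma comm_slices_decoupleable (R : realType) (n : nat) (G : tensor R n) :
  trilinear G -> (forall k l, comm_mx (slice G k) (slice G l)) ->
  fully_decoupleable G.
Proof.
move=> triG comG.
have [_ /mapP[k _ ->]|_ _ /mapP[k _ ->] /mapP[l _ ->]|s ss diags] :=
    @codiagonalizable_symmetric R n (map (slice G) (enum 'I_n)).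
- exact: trilinear_slice_sym.
- exact: comG.
exists s; split=> //; split; first exact: trilinear_act.
have offdiag i j k : i != j -> tensor_act s G i j k = 0.
  move=> nij; have -> : tensor_act s G i j k = slice (tensor_act s G) k i j.
    by rewrite mxE.
  rewrite slice_tensor_act mulmx_sumr mulmx_suml summxE big1 // => l _.
  have /is_diag_mxP sl0 : is_diag_mx (s *m slice G l *m s^T).
    by apply: diags; apply: map_f; rewrite mem_enum.
  by rewrite -scalemxAr -scalemxAl mxE sl0 ?mulr0.
(* If the first two indices agree, the third differs from them, and symmetry moves it to second
   place. *)
move=> i j k nijk; have [ij|] := eqVneq i j; last exact: offdiag.
have [jk|njk] := eqVneq j k; first by case: nijk.
have [-> _] := trilinear_act s triG i j k.
by rewrite offdiag // ij.
Qed.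

(** * Diagonal tensors and the spectrum of [star2] *)

Definition diag_tensor (R : realType) (n : nat) (r : 'I_n -> R) : tensor R n :=
  fun i j k => if (i == j) && (j == k) then r i else 0.

Lemma diag_tensorP (R : realType) (n : nat) (r : 'I_n -> R) :
  diagonal_tensor (diag_tensor r).
Proof.
split=> [i j k|i j k nijk]; last first.
  by rewrite /diag_tensor; case: ifP => // /andP[/eqP ij /eqP jk]; case: nijk.
rewrite /diag_tensor; have [<-|nij] := eqVneq i j.
  by split=> //=; rewrite [k == i]eq_sym andbb.
split=> //=.
by have [<-|//] := eqVneq i k; rewrite (negPf nij).
Qed.

Lemma diagonal_tensorE (R : realType) (n : nat) (D : tensor R n) :
  diagonal_tensor D ->
  forall i j k, D i j k = diag_tensor (fun a => D a a a) i j k.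
Proof.
move=> [_ D0] i j k; rewrite /diag_tensor; case: ifP => [/andP[/eqP<- /eqP<-]//|h].
by apply: D0 => -[ij jk]; rewrite ij jk !eqxx in h.
Qed.

(** [qtilde] is defined from a chosen list of eigenvalues; going through the coefficients of the
    characteristic polynomial frees it from that choice. *)
Lemma qtildeE (R : realType) (n : nat) (G : tensor R n) (l : 'I_n -> R)
    (k : 'I_n) :
  char_poly (star2 G) = \prod_i ('X - (l i)%:P) ->
  qtilde G k = (mesym n R k.+1).@[l].
Proof.
move=> hl; have kn : (k.+1 < n.+1)%N by rewrite ltnS.
have -> : (mesym n R k.+1).@[l] = (mesym n R k.+1).@[tnth [tuple l i | i < n]].
  by apply: meval_eq => i; rewrite tnth_mktuple.
have := mroots_coeff [tuple l i | i < n] (Ordinal kn).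
rewrite big_map big_enum -hl /= qtilde_char_poly => ->.
by rewrite mulrA -expr2 sqrr_sign mul1r.
Qed.

Lemma char_poly_star2_diag (R : realType) (n : nat) (r : 'I_n -> R) :
  char_poly (star2 (diag_tensor r)) = \prod_i ('X - (r i ^+ 2)%:P).
Proof.
have -> : star2 (diag_tensor r) = diag_mx (\row_i r i ^+ 2).
  apply/matrixP => k l; rewrite !mxE (bigD1 k) //=.
  rewrite [X in _ + X]big1 => [|i nik]; last first.
    rewrite big1 // => j _; rewrite /diag_tensor.
    case: ifP => [/andP[/eqP ij /eqP jk]|]; last by rewrite mul0r.
    by rewrite ij jk eqxx in nik.
  rewrite addr0 (bigD1 k) //= [X in _ + X]big1 => [|j njk]; last first.
    by rewrite /diag_tensor (negPf njk) andbF mul0r.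
  rewrite addr0 /diag_tensor !eqxx /=; have [_|_] := eqVneq k l.
    by rewrite expr2 mulr1n.
  by rewrite mulr0.
rewrite char_poly_trig ?diag_mx_is_trig //.
by apply: eq_bigr => i _; rewrite !mxE eqxx.
Qed.

Lemma char_poly_conj_orthogonal (A : comNzRingType) (n : nat) (s M : 'M[A]_n) :
  s *m s^T = 1%:M -> char_poly (s *m M *m s^T) = char_poly M.
Proof.
move=> ss; rewrite /char_poly /char_poly_mx.
have ssP : map_mx polyC s *m map_mx polyC s^T = 1%:M.
  by rewrite -map_mxM ss map_mx1.
rewrite !map_mxM /= -[X in X - _]mulmx1 -ssP mulmxA -scalar_mxC -mulmxBl.
by rewrite -mulmxBr !det_mulmx mulrAC -det_mulmx ssP det1 mul1r.
Qed.

Lemma star2_act (R : realType) (n : nat) (s : 'M[R]_n) (G : tensor R n) :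
  orthogonal_mx s -> star2 (tensor_act s G) = s *m star2 G *m s^T.
Proof.
move=> /mulmx1C ss; apply/matrixP => k l.
rewrite star2_slice !slice_tensor_act mxtrace_conj_orthogonal // !mxE.
rewrite linear_sum mulmx_sumr raddf_sum; apply: eq_bigr => l' _ /=.
rewrite !mxE mulr_suml mulmx_suml raddf_sum; apply: eq_bigr => k' _ /=.
by rewrite linearZ /= -scalemxAl -scalemxAr !mxtraceZ star2_slice; ring.
Qed.

Lemma qtilde_act (R : realType) (n : nat) (s : 'M[R]_n) (G : tensor R n)
    (k : 'I_n) :
  orthogonal_mx s -> qtilde (tensor_act s G) k = qtilde G k.
Proof.
by move=> os; rewrite !qtilde_char_poly star2_act // char_poly_conj_orthogonal.
Qed.

(** [star2 G] is a sum of Gram matrices, those of the matrices [M i] obtained by fixing the upper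
    index, whereas [slice] fixes the last one. *)
Lemma star2_eigenvalue_ge0 (R : realType) (n : nat) (G : tensor R n) (a : R) :
  eigenvalue (star2 G) a -> 0 <= a.
Proof.
case/eigenvalueP => v va v0.
have vN : 0 < (v *m v^T) 0 0 by rewrite lt_def mulmx_tr_eq0 v0 mulmx_tr_ge0.
rewrite -(pmulr_lge0 _ vN).
pose M i : 'M[R]_n := \matrix_(j, k) G i j k.
have AM : star2 G = \sum_i (M i)^T *m M i.
  apply/matrixP => k l; rewrite summxE mxE; apply: eq_bigr => i _.
  by rewrite mxE; apply: eq_bigr => j _; rewrite !mxE.
have -> : a * (v *m v^T) 0 0 = (v *m star2 G *m v^T) 0 0.
  by rewrite va -scalemxAl [in RHS]mxE.
rewrite AM mulmx_sumr mulmx_suml summxE sumr_ge0 // => i _.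
by rewrite mulmxA -[_ *m M i *m _]mulmxA -{2}[M i]trmxK -trmx_mul mulmx_tr_ge0.
Qed.

(** * Signed permutations acting on diagonal tensors *)

Lemma signed_perm_orthogonal (R : realType) (n : nat) (e : 'I_n -> R)
    (p : 'S_n) :
  (forall i, e i ^+ 2 = 1) ->
  orthogonal_mx (\matrix_(i, j) (e i *+ (p i == j))).
Proof.
move=> e1; apply/matrixP => i j; rewrite !mxE (bigD1 (p i)) //= big1 => [|k nk].
  rewrite addr0 !mxE eqxx (inj_eq perm_inj) eq_sym.
  by have [->|_] := eqVneq; rewrite ?mulr0n ?mulr0 // !mulr1n -expr2 e1.
by rewrite !mxE [p i == k]eq_sym (negPf nk) mulr0n mul0r.
Qed.

Lemma tensor_act_signed_perm (R : realType) (n : nat) (e : 'I_n -> R)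
    (p : 'S_n) (G : tensor R n) (i j k : 'I_n) :
  tensor_act (\matrix_(i, j) (e i *+ (p i == j))) G i j k =
  e i * e j * e k * G (p i) (p j) (p k).
Proof.
rewrite /tensor_act (bigD1 (p i)) //= [X in _ + X]big1 => [|a na]; last first.
  rewrite big1 // => b _; rewrite big1 // => c _.
  by rewrite mxE eq_sym (negPf na) mulr0n !mul0r.
rewrite addr0 (bigD1 (p j)) //= [X in _ + X]big1 => [|b nb]; last first.
  rewrite big1 // => c _.
  by rewrite !mxE [p j == b]eq_sym (negPf nb) mulr0n mulr0 !mul0r.
rewrite addr0 (bigD1 (p k)) //= [X in _ + X]big1 => [|c nc]; last first.
  by rewrite !mxE [p k == c]eq_sym (negPf nc) mulr0n mulr0 mul0r.
by rewrite addr0 !mxE !eqxx !mulr1n.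
Qed.

Lemma invariant_diag_signed_perm (R : realType) (n : nat) (I : tensor_poly R n)
    (e r : 'I_n -> R) (p : 'S_n) :
  On_invariant I -> (forall i, e i ^+ 2 = 1) ->
  tensor_eval I (diag_tensor (fun i => e i * r (p i))) =
  tensor_eval I (diag_tensor r).
Proof.
move=> invI e1; have [triD _] := diag_tensorP r.
rewrite -(invI _ _ (signed_perm_orthogonal p e1) triD).
apply: tensor_eval_ext => i j k; rewrite tensor_act_signed_perm /diag_tensor.
rewrite !(inj_eq perm_inj); case: ifP => [/andP[/eqP<- /eqP<-]|_].
  (* The order three is odd, so the sign survives: the cube of [e i] is [e i]. *)
  by rewrite -[e i * e i]expr2 e1 mul1r.
by rewrite mulr0.
Qed.

Lemma diag_restriction (R : realType) (n : nat) (I : tensor_poly R n) :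
  exists p : {mpoly R[n]},
    forall r : 'I_n -> R, p.@[r] = tensor_eval I (diag_tensor r).
Proof.
pose X (v : 'I_#|{: 'I_n * 'I_n * 'I_n}|) : {mpoly R[n]} :=
  let: (i, j, k) := enum_val v in if (i == j) && (j == k) then 'X_i else 0.
exists (I \mPo [tuple X v | v < _]) => r; rewrite comp_mpoly_meval.
apply: meval_eq => v; rewrite tnth_mktuple /X /diag_tensor.
by case: enum_val => [[i j] k]; case: ifP; rewrite ?mevalXU ?meval0.
Qed.

(** * From invariance under signs and permutations to symmetric polynomials in squares *)

Lemma sum_sign_expr (R : comNzRingType) (x : R) (m : nat) :
  \sum_(b : bool) ((-1) ^+ b * x) ^+ m =
  if odd m then 0 else (x ^+ 2) ^+ m./2 *+ 2.
Proof.
rewrite big_bool /= expr0 mul1r expr1 mulN1r exprNn -signr_odd.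
case: ifP => om; first by rewrite expr1 mulN1r addNr.
by rewrite expr0 mul1r -exprM mul2n even_halfK ?om // mulr2n.
Qed.

(** Averaging over all [2 ^ n] sign changes kills each monomial with an odd exponent and fixes the
    others. So [q] keeps only the monomials with all exponents even and halves the exponents. *)
Lemma even_mpolyE (R : numFieldType) (n : nat) (p : {mpoly R[n]}) :
  (forall e r : 'I_n -> R, (forall i, e i ^+ 2 = 1) ->
     p.@[fun i => e i * r i] = p.@[r]) ->
  exists q : {mpoly R[n]},
    forall r : 'I_n -> R, p.@[r] = q.@[fun i => r i ^+ 2].
Proof.
move=> evenp.
exists (\sum_(m <- msupp p | [forall i, ~~ odd (m i)])
          p@_m *: 'X_[[multinom (m i)./2 | i < n]]) => r.
have n2 : (2 ^ n)%:R != 0 :> R by rewrite pnatr_eq0 expn_eq0.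
apply: (mulfI n2); transitivity
    (\sum_(e : {ffun 'I_n -> bool}) p.@[fun i => (-1) ^+ e i * r i]).
  rewrite (eq_bigr (fun=> p.@[r])) => [|e _]; last first.
    by apply: evenp => i; rewrite sqrr_sign.
  by rewrite sumr_const card_ffun card_bool card_ord mulr_natl.
under eq_bigr => e _ do rewrite mevalE.
rewrite exchange_big /= [in RHS]big_mkcond /= raddf_sum mulr_sumr.
apply: eq_bigr => m _ /=; rewrite -mulr_sumr.
(* For one monomial, the sum over sign vectors factors into one two-term sum per variable. *)
rewrite -(bigA_distr_bigA (fun i b => ((-1) ^+ (b : bool) * r i) ^+ m i)) /=.
under eq_bigr => i _ do rewrite sum_sign_expr.
case: ifP => [/forallP even_m|/negbT].
  rewrite mevalZ mevalX mulrCA; congr (_ * _).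
  under eq_bigr => i _ do rewrite (negPf (even_m i)) -mulr_natl.
  rewrite big_split /= prodr_const card_ord natrX; congr (_ * _).
  by apply: eq_bigr => i _; rewrite mnmE.
rewrite negb_forall => /existsP[i /negPn om].
by rewrite (bigD1 i) //= om mul0r mulr0 meval0 mulr0.
Qed.

Lemma meval_msym (R : comNzRingType) (n : nat) (s : 'S_n) (p : {mpoly R[n]})
    (v : 'I_n -> R) :
  (msym s p).@[v] = p.@[fun i => v (s i)].
Proof.
have -> : msym s p = p \mPo [tuple 'X_(s i) | i < n].
  rewrite comp_mpolyE; apply: eq_bigr => m _; rewrite -mul_mpolyC.
  by congr (_ * _); apply: eq_bigr => i _; rewrite tnth_mktuple.
by rewrite comp_mpoly_meval; apply: meval_eq => i; rewrite tnth_mktuple mevalXU.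
Qed.

(** The mean over the symmetric group. It will be applied to a [q] whose symmetry is known only at
    points with square coordinates; the mean is symmetric as a polynomial and keeps the value of [q]
    at such points. *)
Lemma symmetrize_mpoly (R : numFieldType) (n : nat) (q : {mpoly R[n]}) :
  exists2 q' : {mpoly R[n]}, q' \is symmetric &
    forall v : 'I_n -> R, (forall s : 'S_n, q.@[fun i => v (s i)] = q.@[v]) ->
      q'.@[v] = q.@[v].
Proof.
exists (#|{perm 'I_n}|%:R^-1 *: \sum_(s : 'S_n) msym s q).
  apply/issymP => t; rewrite msymZ; congr (_ *: _); rewrite raddf_sum /=.
  rewrite [RHS](reindex_inj (mulIg t)) /=.
  by apply: eq_bigr => s _; rewrite msymMm.
move=> v symv; rewrite mevalZ raddf_sum /=.
under eq_bigr => s _ do rewrite meval_msym symv.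
rewrite sumr_const -[X in _ * X]mulr_natl mulrA mulVf ?mul1r //.
by rewrite pnatr_eq0 card_Sn -lt0n fact_gt0.
Qed.

Lemma invariant_diag_qtilde (R : realType) (n : nat) (I : tensor_poly R n) :
  On_invariant I -> exists F : {mpoly R[n]},
    forall D : tensor R n, diagonal_tensor D -> tensor_eval I D = F.@[qtilde D].
Proof.
move=> invI; have [p pE] := diag_restriction I.
have [|q qE] := @even_mpolyE _ _ p.
  (* Sign changes alone, with the identity permutation, show that [p] is even. *)
  move=> e r e1; rewrite !pE -[RHS](invariant_diag_signed_perm r 1%g invI e1).
  by apply: tensor_eval_ext => i j k; rewrite /diag_tensor perm1.
have [q' /sym_fundamental[F [FE _]] q'E] := symmetrize_mpoly q.
exists F => D diagD; pose r i := D i i i.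
have DE := diagonal_tensorE diagD.
rewrite (tensor_eval_ext _ DE) -pE qE -q'E => [|s]; last first.
  (* Permutations alone, with all signs [1], give the symmetry of [q] at the point of squares. *)
  rewrite -!qE !pE -[RHS](@invariant_diag_signed_perm _ _ _ (fun=> 1) _ s invI).
    by apply: tensor_eval_ext => i j k; rewrite /diag_tensor mul1r.
  by move=> i; rewrite expr1n.
rewrite -FE comp_mpoly_meval; apply: meval_eq => k.
rewrite tnth_mktuple (qtildeE (l := fun i => r i ^+ 2)) // -char_poly_star2_diag.
congr char_poly; apply/matrixP => a b; rewrite !mxE.
by apply: eq_bigr => i _; apply: eq_bigr => j _; rewrite !DE.
Qed.

(** * Necessity and sufficiency of the polynomial conditions *)

Theorem theorem6p1 (R : realType) (n d : nat) (I : 'I_d -> tensor_poly R n)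
    (hn : (2 <= n)%N) (hI : generating_set I) :
  exists F : 'I_d -> {mpoly R[n]},
    (forall D : tensor R n, diagonal_tensor D ->
       forall i, tensor_eval (I i) D = (F i).@[qtilde D]) /\
    (forall G : tensor R n, trilinear G ->
       ((forall i, tensor_eval (I i) G = (F i).@[qtilde G]) <->
        fully_decoupleable G)).
Proof.
case: hI => invI genI.
have /fin_all_exists[F FE] i := invariant_diag_qtilde (invI i).
exists F; split=> [D diagD i|G triG]; first exact: FE.
split=> [IG|[s [os diagsG]] i]; last first.
  (* Both sides of the condition are invariant, so it is carried over from the diagonal form. *)
  transitivity (tensor_eval (I i) (tensor_act s G)); first by rewrite invI.
  transitivity (F i).@[qtilde (tensor_act s G)]; first exact: FE.
  by apply: meval_eq => k; apply: qtilde_act.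
apply: comm_slices_decoupleable => //; apply/noncommutativity_eq0.
pose l := star2_eigenvalues G.
have lE : char_poly (star2 G) = \prod_(a <- l) ('X - a%:P).
  exact/eqP/(xchooseP (star2_spectrum G)).
have l_ge0 i : 0 <= tnth l i.
  apply: (@star2_eigenvalue_ge0 _ _ G).
  rewrite eigenvalue_root_char lE root_prod_XsubC.
  exact: mem_tnth.
(* [star2 D] is diagonal with the squares of these entries, so [D] has the same [qtilde] as [G]. [D]
   need not be known to lie in the orbit of [G]: only values of invariants are compared. *)
pose D := diag_tensor (fun i => Num.sqrt (tnth l i)).
have diagD : diagonal_tensor D := diag_tensorP _.
have qGD k : qtilde G k = qtilde D k.
  rewrite !qtilde_char_poly char_poly_star2_diag lE big_tuple.
  by under [in RHS]eq_bigr => i _ do rewrite sqr_sqrtr //.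
have IGD i : tensor_eval (I i) G = tensor_eval (I i) D.
  transitivity (F i).@[qtilde G]; first exact: IG.
  transitivity (F i).@[qtilde D]; first exact: meval_eq.
  by apply: esym; apply: FE.
(* On trilinear tensors the commutator invariant is a polynomial [P] in the generators, hence takes
   the same value at [G] and at [D], where it is zero. *)
have [P PE] := genI _ (@noncommutativity_poly_invariant R n).
have [triD _] := diagD.
rewrite -tensor_eval_noncommutativity (PE G triG) (meval_eq _ IGD) -(PE D triD).
rewrite tensor_eval_noncommutativity; apply/noncommutativity_eq0.
exact: diagonal_slice_comm.
Qed.
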